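(* Let $X,Y$ be real Banach spaces, $A\subseteq X$ a nonempty closed convex set, $C\subseteq Y$ a closed convex cone with nonempty interior, and $F:X\to Y$ a continuous linear map with $F(X)\cap\operatorname{int}C\neq\emptyset$. Let $\theta$ be the associated merit function, assumed to satisfy $\theta(x)<+\infty$ for all $x\in X$, let $\widehat A=X\setminus(A+\operatorname{int}C_X)$ with $C_X=F^{-1}(C)$, and let $\bar x\in E_w$. Then: (i) $T_{E_w}(\bar x)\subseteq T_A(\bar x)\cap T_{\widehat A}(\bar x)\subseteq\{d\in T_A(\bar x):\theta'(\bar x;d)=0\}$. (ii) If $\theta$ has a local error bound at $\bar x$, then $$T_{E_w}(\bar x)=T_A(\bar x)\cap T_{\widehat A}(\bar x)=\{d\in T_A(\bar x):\theta'(\bar x;d)=0\}.$$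
   Context: $d(x,D)=d_D(x)=\inf_{u\in D}\|x-u\|$ with $d_\emptyset\equiv+\infty$; $\Delta_D(y)=d_D(y)-d_{Y\setminus D}(y)$ with conventions $\Delta_\emptyset\equiv+\infty$, $\Delta_Y\equiv-\infty$. $C^+=\{y^*\in Y^*:\langle y^*,c\rangle\ge 0\ \forall c\in C\}$, $S(C^+)=\{y^*\in C^+:\|y^*\|=1\}$. The merit function is $$\theta(x)=\sup_{a\in A}\bigl(-\Delta_C(F(x)-F(a))\bigr)=\sup_{a\in A}\inf_{y^*\in S(C^+)}\langle y^*,F(x)-F(a)\rangle .$$ $E_w=\{\bar x\in A: F(\bar x)\notin F(A)+\operatorname{int}C\}$ is the weakly efficient solution set; one has $E_w=A\cap\widehat A$. For a nonempty set $D\subseteq X$ and $x\in D$, $T_D(x)=\{d\in X:\exists t_k\downarrow0,\ \exists d_k\to d,\ x+t_kd_k\in D\}$. $\theta'(x;d)=\lim_{t\downarrow0}\frac{\theta(x+td)-\theta(x)}{t}$, which exists and is finite since $\theta$ is concave and Lipschitz. $\theta$ has a local error bound at $x_0\in E_w$ if there exist $\tau>0$ and $\delta>0$ with $d(x,E_w)\le\tau\theta(x)$ for all $x\in A\cap B(x_0,\delta)$, where $B(x_0,\delta)$ is the open ball. *)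

(* Defs.v *)
From HB Require Import structures.
From mathcomp Require Import all_boot all_order all_algebra.
From mathcomp Require Import all_classical all_reals all_analysis.

Set Implicit Arguments.
Unset Strict Implicit.
Unset Printing Implicit Defensive.

Import Order.TTheory GRing.Theory Num.Theory.
Import numFieldNormedType.Exports.

Local Open Scope classical_set_scope.
Local Open Scope ring_scope.

Definition is_cone (R : realType) (Y : normedModType R) (C : set Y) : Prop :=
  forall (t : R) (c : Y), 0 <= t -> C c -> C (t *: c).

Definition set_add (R : realType) (V : normedModType R) (A B : set V) : set V :=
  [set a + b | a in A & b in B].

(* Extended-real valued: the infimum over the empty set is +oo. *)
Definition set_dist (R : realType) (V : normedModType R) (D : set V) (x : V) :
    \bar R :=
  ereal_inf [set (`|x - u|)%:E | u in D].

(* The oriented distance.  The conventions for the empty set (+oo) and for the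
   whole space (-oo) hold automatically, as +oo - 0 and 0 - +oo. *)
Definition oriented_dist (R : realType) (Y : normedModType R) (D : set Y)
    (y : Y) : \bar R :=
  (set_dist D y - set_dist (~` D) y)%E.

Definition merit (R : realType) (X Y : normedModType R) (A : set X) (C : set Y)
    (F : X -> Y) (x : X) : \bar R :=
  ereal_sup [set (- oriented_dist C (F x - F a)%R)%E | a in A].

Definition weakly_efficient (R : realType) (X Y : normedModType R)
    (A : set X) (C : set Y) (F : X -> Y) : set X :=
  [set x | A x /\ ~ set_add (F @` A) (interior C) (F x)].

Definition hat_set (R : realType) (X Y : normedModType R)
    (A : set X) (C : set Y) (F : X -> Y) : set X :=
  ~` set_add A (interior (F @^-1` C)).

(* t_k decreasing to 0 is read as t_k > 0 and t_k --> 0; passing to a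
   subsequence makes t_k monotone, so the cone does not depend on this. *)
Definition tangent_cone (R : realType) (X : normedModType R) (D : set X)
    (x : X) : set X :=
  [set d | exists (t : nat -> R) (e : nat -> X),
    [/\ forall k, 0 < t k,
        t k @[k --> \oo] --> (0 : R),
        e k @[k --> \oo] --> d &
        forall k, D (x + t k *: e k)]].

(* The one-sided directional derivative f'(x; d) exists and equals l.  A
   relation is used because lim has a default value when no limit exists. *)
Definition is_dirderiv (R : realType) (X : normedModType R) (f : X -> \bar R)
    (x d : X) (l : \bar R) : Prop :=
  ((f (x + t *: d)%R - f x) * (t^-1)%:E)%E @[t --> (0 : R)^'+] --> l.

Definition local_error_bound (R : realType) (X Y : normedModType R)
    (A : set X) (C : set Y) (F : X -> Y) (x0 : X) : Prop :=
  exists tau delta : R,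
    [/\ 0 < tau, 0 < delta &
        forall x, A x -> ball x0 delta x ->
          (set_dist (weakly_efficient A C F) x <= tau%:E * merit A C F x)%E].

(* Main.v *)
Require Import Defs.
From HB Require Import structures.
From mathcomp Require Import all_boot all_order all_algebra.
From mathcomp Require Import all_classical all_reals all_analysis.
From mathcomp Require Import ring lra.
Import Order.TTheory GRing.Theory Num.Theory.
Import numFieldNormedType.Exports.
Local Open Scope classical_set_scope.
Local Open Scope ring_scope.
Set Implicit Arguments.
Unset Strict Implicit.
Unset Printing Implicit Defensive.

(* The function -Delta_C is Lipschitz and positively homogeneous, is >= 0 on C
   and <= 0 off int C.  Hence theta is Lipschitz, theta >= 0 on A, theta <= 0 on
   Ahat, and theta (xbar + l v) >= l theta (xbar + v) for 0 < l <= 1; full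
   concavity is not needed.  So t |-> theta (xbar + t d) / t is nonincreasing,
   and its limit at 0+ is squeezed to 0 by one sequence tangent to A and another
   tangent to Ahat.  Conversely, if the derivative vanishes, theta is o(t) along
   a sequence tangent to A, and the error bound puts E_w at distance o(t). *)

(** * Distance to a set and the oriented distance *)

Lemma set_dist_ge0 (R : realType) (V : normedModType R) (D : set V) (x : V) :
  (0 <= set_dist D x)%E.
Proof. by apply/ereal_infP => _ [u _ <-]; rewrite lee_fin. Qed.

Lemma set_dist_le (R : realType) (V : normedModType R) (D : set V) (x u : V) :
  D u -> (set_dist D x <= (`|x - u|)%:E)%E.
Proof. by move=> Du; apply: ereal_inf_lbound; exists u. Qed.

Lemma set_dist_fin (R : realType) (V : normedModType R) (D : set V) (x : V) :
  D !=set0 -> set_dist D x \is a fin_num.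
Proof.
move=> [u Du]; rewrite ge0_fin_numE ?set_dist_ge0//.
exact: le_lt_trans (set_dist_le x Du) (ltry _).
Qed.

Lemma set_dist_lip (R : realType) (V : normedModType R) (D : set V) (x y : V) :
  (set_dist D x <= set_dist D y + (`|x - y|)%:E)%E.
Proof.
rewrite -leeBlDr//; apply/ereal_infP => _ [u Du <-].
rewrite leeBlDr//; apply: le_trans (set_dist_le x Du) _.
by rewrite -EFinD lee_fin [leRHS]addrC ler_distD.
Qed.

(** A set stable under all positive scalings is mapped onto itself by [u |-> l *: u], the inverse
    being scaling by [l^-1]. The infimum therefore only changes by the factor [l]. *)
Lemma set_dist_scale (R : realType) (V : normedModType R) (D : set V)
    (l : R) (x : V) :
  (forall s v, 0 < s -> D v -> D (s *: v)) -> 0 < l ->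
  set_dist D (l *: x) = (l%:E * set_dist D x)%E.
Proof.
move=> Ds l0; rewrite /set_dist -ereal_inf_pZl//; congr ereal_inf.
apply/seteqP; split=> [_ [u Du <-]|_ [_ [u Du <-] <-]].
  exists (`|x - l^-1 *: u|)%:E.
    by exists (l^-1 *: u) => //; apply: Ds => //; rewrite invr_gt0.
  by rewrite -EFinM -{1}(gtr0_norm l0) -normrZ scalerBr scalerA divff ?gt_eqF//
    scale1r.
exists (l *: u); first exact: Ds.
by rewrite -scalerBr normrZ gtr0_norm.
Qed.

(** A real-valued form of the negated oriented distance. As [fine] sends infinities to 0, the two
    agree only once [D] and its complement are known to be nonempty. *)
Definition neg_oriented_dist (R : realType) (V : normedModType R) (D : set V)
    (y : V) : R := fine (set_dist (~` D) y) - fine (set_dist D y).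

Lemma neg_oriented_distE (R : realType) (V : normedModType R) (D : set V)
    (y : V) : D !=set0 -> ~` D !=set0 ->
  (- oriented_dist D y)%E = (neg_oriented_dist D y)%:E.
Proof.
move=> D0 D0'; rewrite /oriented_dist /neg_oriented_dist.
by rewrite -(fineK (set_dist_fin y D0)) -(fineK (set_dist_fin y D0'))
  -EFinB -EFinN opprB.
Qed.

(** Each of the two distances is 1-Lipschitz, whence the constant 2. *)
Lemma neg_oriented_dist_lip (R : realType) (V : normedModType R) (D : set V)
    (y z : V) : D !=set0 -> ~` D !=set0 ->
  neg_oriented_dist D y <= neg_oriented_dist D z + 2 * `|y - z|.
Proof.
move=> D0 D0'; rewrite /neg_oriented_dist.
have := set_dist_lip (~` D) y z; have := set_dist_lip D z y.
rewrite -(fineK (set_dist_fin y D0)) -(fineK (set_dist_fin y D0')).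
rewrite -(fineK (set_dist_fin z D0)) -(fineK (set_dist_fin z D0')).
by rewrite -!EFinD !lee_fin/= (distrC z y); lra.
Qed.

(** The complement of a cone is also stable under positive scalings, so both distances are
    positively homogeneous. *)
Lemma neg_oriented_dist_scale (R : realType) (V : normedModType R) (C : set V)
    (l : R) (y : V) : is_cone C -> 0 < l ->
  neg_oriented_dist C (l *: y) = l * neg_oriented_dist C y.
Proof.
move=> Ccone l0; rewrite /neg_oriented_dist !set_dist_scale//.
- have fineZ (z : \bar R) : fine (l%:E * z) = l * fine z.
    by case: z => [r||]//; rewrite ?gt0_muley ?gt0_muleNy ?lte_fin//= mulr0.
  by rewrite !fineZ mulrBr.
- by move=> s v s0; apply: Ccone; exact: ltW.
move=> s v s0; apply: contra_not => Csv.
rewrite -[v]scale1r -(mulVf (lt0r_neq0 s0)) -scalerA; apply: Ccone => //.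
by rewrite invr_ge0 ltW.
Qed.

Lemma neg_oriented_dist_ge0 (R : realType) (V : normedModType R) (D : set V)
    (y : V) : D y -> 0 <= neg_oriented_dist D y.
Proof.
move=> Dy; rewrite /neg_oriented_dist.
have -> : set_dist D y = 0%E.
  apply/eqP; rewrite eq_le set_dist_ge0 andbT.
  by apply: le_trans (set_dist_le y Dy) _; rewrite subrr normr0.
by rewrite subr0 fine_ge0// set_dist_ge0.
Qed.

Lemma neg_oriented_dist_le0 (R : realType) (V : normedModType R) (D : set V)
    (y : V) : ~ interior D y -> neg_oriented_dist D y <= 0.
Proof.
move=> nDy; rewrite /neg_oriented_dist.
suff -> : set_dist (~` D) y = 0%E by rewrite sub0r oppr_le0 fine_ge0 ?set_dist_ge0.
apply/eqP; rewrite eq_le set_dist_ge0 andbT leNgt; apply/negP => dpos; apply: nDy.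
(* The distance is infinite when the complement of [D] is empty; any radius then works, and 1 is
   taken. *)
have [r /= r0 rd] : exists2 r : R, 0 < r & (r%:E <= set_dist (~` D) y)%E.
  move: dpos; case: (set_dist _ _) => [r r0|_|//]; first by exists r.
  by exists 1 => //; rewrite leey.
apply/nbhs_ballP; exists r => // z; rewrite -ball_normE /= => yz.
apply: contrapT => nDz; move: (le_trans rd (set_dist_le y nDz)).
by rewrite lee_fin leNgt yz.
Qed.

(** * Sequence-free tangent cones and monotone quotients *)

Lemma tangent_coneP (R : realType) (X : normedModType R) (D : set X) (x d : X) :
  tangent_cone D x d <-> forall eps : R, 0 < eps -> exists (t : R) (e : X),
    [/\ 0 < t, t < eps, `|e - d| < eps & D (x + t *: e)].
Proof.
split=> [[t [e [t0 tc ec Dte]]] eps eps0|H].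
  near \oo => k; exists (t k), (e k); split=> //.
    near: k; move/cvgrPdist_lt : tc => /(_ _ eps0); apply: filterS => k.
    by rewrite sub0r normrN gtr0_norm.
  by near: k; move/cvgrPdistC_lt : ec; exact.
(* Choosing a witness for [eps = 1 / (k + 1)] rebuilds both sequences at once, since one [eps]
   bounds the step and the direction error. *)
have {}H (k : nat) : {te : R * X | [/\ 0 < te.1, te.1 < k.+1%:R^-1,
    `|te.2 - d| < k.+1%:R^-1 & D (x + te.1 *: te.2)]}.
  apply: cid; have [|t [e ?]] := H k.+1%:R^-1; first by rewrite invr_gt0.
  by exists (t, e).
exists (fun k => (sval (H k)).1), (fun k => (sval (H k)).2); split.
- by move=> k; case: (svalP (H k)).
- apply/cvgrPdist_lt => _/posnumP[eps]; near=> k.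
  case: (svalP (H k)) => t0 tk _ _; rewrite sub0r normrN gtr0_norm//.
  by apply: lt_trans tk _; near: k; exact: near_infty_natSinv_lt.
- apply/cvgrPdistC_lt => _/posnumP[eps]; near=> k.
  case: (svalP (H k)) => _ _ ek _.
  by apply: lt_trans ek _; near: k; exact: near_infty_natSinv_lt.
- by move=> k; case: (svalP (H k)).
Unshelve. all: by end_near. Qed.

Lemma tangent_coneS (R : realType) (X : normedModType R) (D E : set X) (x : X) :
  D `<=` E -> tangent_cone D x `<=` tangent_cone E x.
Proof.
move=> DE d [t [e [t0 tc ec Dte]]]; exists t, e; split=> // k.
exact: DE.
Qed.

(** Since [q] is nonincreasing, a lower bound at one point holds at every smaller [t]. An upper
    bound at [t] comes from any smaller point, and such points exist arbitrarily close to 0. *)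
Lemma cvg_quotient0 (R : realType) (q : R -> R) :
  (forall s t, 0 < s -> s <= t -> q t <= q s) ->
  (forall eps, 0 < eps -> exists t, [/\ 0 < t, t < eps & - eps <= q t]) ->
  (forall eps, 0 < eps -> exists t, [/\ 0 < t, t < eps & q t <= eps]) ->
  q t @[t --> 0^'+] --> 0.
Proof.
move=> qmono lb ub; apply/cvgrPdist_le => eps eps0.
have [t0 [t00 _ qt0]] := lb _ eps0.
near=> t; have tgt0 : 0 < t by near: t; exact: nbhs_right_gt.
rewrite sub0r normrN ler_norml; apply/andP; split.
  by apply: le_trans qt0 _; apply: qmono => //; near: t; exact: nbhs_right_le.
have [|s [s0 st qs]] := ub (Num.min eps t); first by rewrite lt_min eps0.
apply: le_trans (qmono s t s0 _) (le_trans qs _).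
  by apply: le_trans (ltW st) _; rewrite ge_min lexx orbT.
by rewrite ge_min lexx.
Unshelve. all: by end_near. Qed.

(** * Properness of the cone, convexity and interiors *)

Lemma merit_lty_setC_neq0 (R : realType) (X Y : normedModType R) (A : set X)
    (C : set Y) (F : X -> Y) (x : X) :
  A !=set0 -> C !=set0 -> (merit A C F x < +oo)%E -> ~` C !=set0.
Proof.
move=> [a Aa] C0 mlty; apply/set0P/eqP => CC0; move: mlty.
(* If [C] were the whole space, the distance to its empty complement would be infinite and every
   term of the supremum would be [+oo]. *)
suff -> : merit A C F x = +oo%E by [].
apply: ereal_supy; exists a => //; rewrite /oriented_dist CC0.
rewrite [set_dist set0 _](_ : _ = +oo%E).
  by rewrite -(fineK (set_dist_fin (F x - F a) C0)).
by rewrite /set_dist image_set0 ereal_inf0.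
Qed.

Lemma convex_cone_add (R : realType) (Y : normedModType R) (C : set Y)
    (y z : Y) : convex_set C -> is_cone C -> C y -> C z -> C (y + z).
Proof.
move=> Ccvx Ccone Cy Cz.
have h0 : 0 <= 2^-1 :> R by lra.
have h1 : 2^-1 <= 1 :> R by lra.
have Cyz : C (2^-1 *: y + (1 - 2^-1) *: z).
  exact: set_mem (Ccvx y z (Itv01 h0 h1) (mem_set Cy) (mem_set Cz)).
have := Ccone 2 _ (ler0n _ 2) Cyz.
rewrite scalerDr !scalerA mulfV// scale1r.
by rewrite [2 * _](_ : _ = 1) ?scale1r//; field.
Qed.

Lemma convex_set_scale (R : realType) (X : normedModType R) (A : set X)
    (x y : X) (l : R) :
  convex_set A -> 0 < l -> l <= 1 -> A x -> A y -> A (x + l *: (y - x)).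
Proof.
move=> Acvx l0 l1 Ax Ay.
have H : A (l *: y + (1 - l) *: x).
  exact: set_mem (Acvx y x (Itv01 (ltW l0) l1) (mem_set Ay) (mem_set Ax)).
suff -> : x + l *: (y - x) = l *: y + (1 - l) *: x by [].
by rewrite scalerBl scale1r scalerBr addrCA.
Qed.

(* This inclusion is where the hypothesis that F meets the interior of C enters. *)
Lemma interior_preimage_cone (R : realType) (X Y : normedModType R) (C : set Y)
    (F : {linear X -> Y}) :
  convex_set C -> is_cone C -> (range F `&` interior C) !=set0 ->
  interior (F @^-1` C) `<=` F @^-1` interior C.
Proof.
move=> Ccvx Ccone [_ [[e _ <-] Ce]] x /nbhs_ballP[r /= r0 xr].
(* This [s] makes [s *: e] shorter than [r], so [x - s *: e] stays in the ball. Then [F x] is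
   [F (x - s *: e)], a point of [C], plus [s *: F e], where [F e] is interior to [C]. *)
pose s : R := r / (2 * (1 + `|e|)).
have e1 : 0 < 1 + `|e| by rewrite ltr_pwDl.
have s0 : 0 < s by rewrite divr_gt0// mulr_gt0.
have Cxe : C (F (x - s *: e)).
  apply: xr; rewrite -ball_normE /= opprB addrC subrK normrZ gtr0_norm//.
  rewrite /s mulrAC ltr_pdivrMr ?mulr_gt0// ltr_pM2l//; have := normr_ge0 e; lra.
(* This affine map sends [F x] to [F e], so points [w] near [F x] have images in [C]; adding back
   the point [F (x - s *: e)] of [C] shows [w] in [C]. *)
have cont : (fun w => s^-1 *: (w - F (x - s *: e))) @ F x --> F e.
  have -> : F e = s^-1 *: (F x - F (x - s *: e)).
    by rewrite (linearB F)/= opprB addrC subrK linearZ/= scalerA mulVf ?gt_eqF// scale1r.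
  by apply: cvgZr; apply: cvgB; [exact: cvg_id|exact: cvg_cst].
have := cont _ Ce; rewrite /= /interior /nbhs/=; apply: filterS => w /= Cw.
have := convex_cone_add Ccvx Ccone Cxe (Ccone s _ (ltW s0) Cw).
by rewrite scalerA mulfV ?gt_eqF// scale1r addrC subrK.
Qed.

Lemma weakly_efficient_hat_set (R : realType) (X Y : normedModType R)
    (A : set X) (C : set Y) (F : {linear X -> Y}) :
  convex_set C -> is_cone C -> (range F `&` interior C) !=set0 ->
  weakly_efficient A C F `<=` hat_set A C F.
Proof.
move=> Ccvx Ccone Fint x [_ nFx] [a Aa [c Cc xE]]; apply: nFx.
exists (F a); first by exists a.
exists (F c); last by rewrite -linearD xE.
exact: interior_preimage_cone Cc.
Qed.

(** * Sign, finiteness, Lipschitz and scaling properties of the merit function *)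

Lemma merit_ge0 (R : realType) (X Y : normedModType R) (A : set X) (C : set Y)
    (F : X -> Y) (x : X) :
  is_cone C -> C !=set0 -> ~` C !=set0 -> A x -> (0 <= merit A C F x)%E.
Proof.
(* The competitor [a = x] already gives a nonnegative term, since [C] contains 0. *)
move=> Ccone C0 C0' Ax; apply: (@le_trans _ _ (- oriented_dist C (F x - F x)%R)%E).
  rewrite neg_oriented_distE// lee_fin neg_oriented_dist_ge0// subrr.
  by have [c Cc] := C0; rewrite -(scale0r c); exact: Ccone.
by apply: ereal_sup_ubound; exists x.
Qed.

(** If [F x - F a] were interior to [C], continuity would make [x - a] interior to the preimage of
    [C], against [x] being in the hat set. So every term of the supremum is nonpositive. *)
Lemma merit_le0 (R : realType) (X Y : normedModType R) (A : set X) (C : set Y)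
    (F : {linear X -> Y}) (x : X) :
  continuous F -> C !=set0 -> ~` C !=set0 -> hat_set A C F x ->
  (merit A C F x <= 0)%E.
Proof.
move=> Fcont C0 C0' xhat; apply/ereal_supP => _ [a Aa <-].
rewrite neg_oriented_distE// lee_fin neg_oriented_dist_le0// => Cxa; apply: xhat.
exists a => //; exists (x - a); last by rewrite addrC subrK.
by apply: Fcont; rewrite linearB.
Qed.

Lemma merit_fin (R : realType) (X Y : normedModType R) (A : set X) (C : set Y)
    (F : X -> Y) (x : X) : A !=set0 -> C !=set0 -> ~` C !=set0 ->
  (merit A C F x < +oo)%E -> merit A C F x \is a fin_num.
Proof.
move=> [a Aa] C0 C0' mlty; rewrite fin_numE (lt_eqF mlty) andbT gt_eqF//.
apply: (@lt_le_trans _ _ (- oriented_dist C (F x - F a)%R)%E).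
  by rewrite neg_oriented_distE// ltNyr.
by apply: ereal_sup_ubound; exists a.
Qed.

(** All terms of the supremum share the Lipschitz constant [2 * L], with [L] a bound for the
    operator [F]. *)
Lemma merit_lip (R : realType) (X Y : normedModType R) (A : set X) (C : set Y)
    (F : {linear X -> Y}) : continuous F -> C !=set0 -> ~` C !=set0 ->
  exists2 M : R, 0 <= M & forall x y,
    (merit A C F x <= merit A C F y + (M * `|x - y|)%:E)%E.
Proof.
move=> /linear_bounded_continuous/linear_boundedP Fb C0 C0'.
have [L L0 FL] := pinfty_ex_gt0 Fb.
exists (2 * L) => [|x y]; first by rewrite mulr_ge0// ltW.
apply/ereal_supP => _ [a Aa <-].
apply: (@le_trans _ _ (- oriented_dist C (F y - F a)%R + (2 * L * `|x - y|)%:E)%E).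
  rewrite !neg_oriented_distE// -EFinD lee_fin.
  apply: le_trans (neg_oriented_dist_lip _ (F y - F a) C0 C0') _.
  rewrite lerD2l opprB addrA subrK -linearB -mulrA ler_pM2l//; exact: FL.
by rewrite leeD2r//; apply: ereal_sup_ubound; exists a.
Qed.

(* A competitor a for x + v gives the competitor x + l (a - x) for x + l v, and
   the two image differences are proportional. *)
Lemma merit_scale (R : realType) (X Y : normedModType R) (A : set X) (C : set Y)
    (F : {linear X -> Y}) (x v : X) (l : R) :
  convex_set A -> is_cone C -> C !=set0 -> ~` C !=set0 -> A x ->
  0 < l -> l <= 1 ->
  (l%:E * merit A C F (x + v)%R <= merit A C F (x + l *: v)%R)%E.
Proof.
move=> Acvx Ccone C0 C0' Ax l0 l1; rewrite -lee_pdivlMl//.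
apply/ereal_supP => _ [a Aa <-]; rewrite lee_pdivlMl//.
apply: (@le_trans _ _
  (- oriented_dist C (F (x + l *: v) - F (x + l *: (a - x)))%R)%E).
  rewrite !neg_oriented_distE// -EFinM lee_fin -neg_oriented_dist_scale//.
  rewrite -!linearB -linearZ/= opprD addrACA subrr add0r -scalerBr.
  by rewrite opprB addrA (addrC v).
by apply: ereal_sup_ubound; exists (x + l *: (a - x)) => //; exact: convex_set_scale.
Qed.

(** * Directional derivatives against tangent directions *)

Lemma is_dirderiv_EFin (R : realType) (X : normedModType R) (f : X -> R)
    (x d : X) (l : R) :
  is_dirderiv (EFin \o f) x d l%:E <->
  (f (x + t *: d) - f x) / t @[t --> 0^'+] --> l.
Proof.
rewrite /is_dirderiv; split=> [/fine_cvgP[_]//|H].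
by apply/fine_cvgP; split=> //; exact: nearW.
Qed.

Lemma dirderiv_tangent_cones (R : realType) (X : normedModType R) (f : X -> R)
    (A B : set X) (x d : X) (M : R) :
  0 <= M -> (forall y z, f y <= f z + M * `|y - z|) -> f x = 0 ->
  (forall l v, 0 < l -> l <= 1 -> l * f (x + v) <= f (x + l *: v)) ->
  (forall y, A y -> 0 <= f y) -> (forall y, B y -> f y <= 0) ->
  tangent_cone A x d -> tangent_cone B x d ->
  (f (x + t *: d) - f x) / t @[t --> 0^'+] --> 0.
Proof.
move=> M0 flip fx0 fscale fA fB /tangent_coneP TA /tangent_coneP TB.
have M1 : 0 < M + 1 by rewrite ltr_wpDl.
(* The radius [e] must control both the step length and the Lipschitz error [M * e] made when
   replacing the tangent direction by [d]. *)
have rescale eps : 0 < eps -> exists2 e, 0 < e & e <= eps /\ M * e <= eps.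
  move=> eps0; exists (eps / (M + 1)); first exact: divr_gt0.
  split; first by rewrite ler_pdivrMr// ler_peMr ?(ltW eps0)// lerDr.
  by rewrite mulrA ler_pdivrMr// mulrC ler_pM2l// lerDl.
have dist t e : 0 < t -> `|(x + t *: e) - (x + t *: d)| = t * `|e - d|.
  by move=> t0; rewrite opprD addrACA subrr add0r -scalerBr normrZ gtr0_norm.
under eq_fun do rewrite fx0 subr0.
apply: cvg_quotient0 => [s t s0 st|eps /rescale[r r0 [reps Mr]]|
    eps /rescale[r r0 [reps Mr]]].
- have t0 : 0 < t by exact: lt_le_trans st.
  (* Scaling [t *: d] by [s / t] compares the quotients at [s] and [t]. *)
  have := fscale (s / t) (t *: d) (divr_gt0 s0 t0).
  rewrite ler_pdivrMr// mul1r => /(_ st).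
  rewrite scalerA divfK ?gt_eqF// ler_pdivlMr// => H.
  by apply: le_trans H; rewrite mulrC mulrA mulrAC lexx.
- have [t [e [t0 tr er Ae]]] := TA _ r0.
  exists t; split=> //; first exact: lt_le_trans reps.
  rewrite ler_pdivlMr//.
  have := flip (x + t *: e) (x + t *: d); rewrite dist// => H.
  have {H} := le_trans (fA _ Ae) H.
  have : M * (t * `|e - d|) <= eps * t.
    rewrite mulrCA mulrC ler_pM2r//; apply: le_trans Mr.
    by rewrite ler_wpM2l// ltW.
  lra.
have [t [e [t0 tr er Be]]] := TB _ r0.
exists t; split=> //; first exact: lt_le_trans reps.
rewrite ler_pdivrMr//.
have := flip (x + t *: d) (x + t *: e); rewrite distrC dist// => H.
have : M * (t * `|e - d|) <= eps * t.
  rewrite mulrCA mulrC ler_pM2r//; apply: le_trans Mr.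
  by rewrite ler_wpM2l// ltW.
have := fB _ Be; lra.
Qed.

(* The tangent sequence in A lies within o(t) of E; near-projections onto E give
   the tangent sequence in E. *)
Lemma tangent_cone_error_bound (R : realType) (X : normedModType R) (f : X -> R)
    (A E : set X) (x d : X) (M tau delta : R) :
  0 <= M -> (forall y z, f y <= f z + M * `|y - z|) -> f x = 0 ->
  0 < tau -> 0 < delta ->
  (forall y, A y -> ball x delta y -> (set_dist E y <= (tau * f y)%:E)%E) ->
  tangent_cone A x d ->
  (f (x + t *: d) - f x) / t @[t --> 0^'+] --> 0 ->
  tangent_cone E x d.
Proof.
move=> M0 flip fx0 tau0 delta0 eb /tangent_coneP TA /cvgrPdist_le df.
apply/tangent_coneP => eta eta0.
(* Error budget in units of [eps]: one for [e - d], [tau * (1 + M)] from the error bound, one for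
   the near-projection; the 3 covers the constant terms. *)
pose K := 3 + tau * (1 + M).
have K0 : 0 < K by rewrite addr_gt0// mulr_gt0// ltr_wpDr.
pose eps := eta / K; have eps0 : 0 < eps by exact: divr_gt0.
have [r /= r0 dfr] := df _ eps0.
(* Since [e] has norm below [|d| + eps], steps [t < rho] keep [x + t *: e] in the ball where the
   error bound holds. *)
pose rho := delta / (`|d| + eps + 1).
have D0 : 0 < `|d| + eps + 1 by rewrite ltr_wpDl// addr_ge0// ltW.
have rho0 : 0 < rho by exact: divr_gt0.
have [|t [e [t0]]] := TA (Num.min (Num.min eps eta) (Num.min r rho)).
  by rewrite !lt_min eps0 eta0 r0 rho0.
rewrite !lt_min => /andP[/andP[teps teta] /andP[tr trho]].
move=> /andP[/andP[eeps _] _] Ae.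
have fd : f (x + t *: d) <= eps * t.
  have := dfr t; rewrite /= sub0r normrN gtr0_norm// => /(_ tr t0).
  by rewrite fx0 subr0 sub0r normrN => /(le_trans (ler_norm _)); rewrite ler_pdivrMr.
have fe : f (x + t *: e) <= eps * t + M * (t * eps).
  apply: le_trans (flip _ (x + t *: d)) _; apply: lerD => //.
  rewrite opprD addrACA subrr add0r -scalerBr normrZ gtr0_norm//.
  by rewrite ler_wpM2l// ler_pM2l// ltW.
have bxe : ball x delta (x + t *: e).
  rewrite -ball_normE /= opprD addrA subrr add0r normrN normrZ gtr0_norm//.
  apply: (@le_lt_trans _ _ (t * (`|d| + eps + 1))).
    rewrite ler_pM2l// -[e](subrK d); apply: le_trans (ler_normD _ _) _; lra.
  by rewrite -ltr_pdivlMr.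
(* The infimum may not be attained; the slack [t * eps] yields an actual point [u] of [E]. *)
have [_ [u Eu <-] ud] : exists2 z, [set (`|x + t *: e - v|)%:E | v in E] z &
    (z < (tau * (eps * t + M * (t * eps)) + t * eps)%:E)%E.
  apply: ereal_inf_lt; apply: le_lt_trans (eb _ Ae bxe) _.
  by rewrite lte_fin; apply: ltr_pwDr; [exact: mulr_gt0|rewrite ler_pM2l].
(* With this direction, a step of length [t] from [x] lands exactly on [u]. *)
exists t, (t^-1 *: (u - x)); split=> //; last first.
  by rewrite scalerA divff ?gt_eqF// scale1r addrC subrK.
have -> : t^-1 *: (u - x) - d = (e - d) - t^-1 *: (x + t *: e - u).
  rewrite addrAC -{1}(scalerK (lt0r_neq0 t0) e) -scalerBr.
  by congr (_ *: _ - d); rewrite opprB addrCA (addrC x) opprD addNKr.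
apply: le_lt_trans (ler_normB _ _) _.
rewrite normrZ gtr0_norm ?invr_gt0// mulrC.
rewrite lte_fin in ud.
have etaE : eta = K * eps by rewrite mulrC divfK// gt_eqF.
have {}ud : `|x + t *: e - u| / t < tau * (1 + M) * eps + eps.
  by rewrite ltr_pdivrMr//; apply: lt_le_trans ud _; lra.
rewrite etaE /K; lra.
Qed.

Unset Implicit Arguments.
Set Strict Implicit.
Set Printing Implicit Defensive.

Theorem theorem5p7 (R : realType) (X Y : completeNormedModType R)
    (A : set X) (C : set Y) (F : {linear X -> Y}) (xbar : X)
    (A_nonempty : A !=set0) (A_closed : closed A) (A_convex : convex_set A)
    (C_closed : closed C) (C_convex : convex_set C) (C_cone : is_cone C)
    (C_int : interior C !=set0)
    (F_continuous : continuous F)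
    (F_int : (range F `&` interior C) !=set0)
    (merit_lty : forall x : X, (merit A C F x < +oo)%E)
    (xbar_eff : weakly_efficient A C F xbar) :
  let Ew := weakly_efficient A C F in
  let Ahat := hat_set A C F in
  let TAcap := tangent_cone A xbar `&` tangent_cone Ahat xbar in
  let K := [set d | tangent_cone A xbar d /\
                    is_dirderiv (merit A C F) xbar d 0%E] in
  (tangent_cone Ew xbar `<=` TAcap /\ TAcap `<=` K) /\
  (local_error_bound A C F xbar ->
     tangent_cone Ew xbar = TAcap /\ TAcap = K).

Proof.
move=> Ew Ahat TAcap K.
have C0 : C !=set0 by have [c /interior_subset Cc] := C_int; exists c.
have C0' := merit_lty_setC_neq0 A_nonempty C0 (merit_lty xbar).
pose f x := fine (merit A C F x).
(* The merit function is finite everywhere, so passing to [fine] loses nothing and the real-valued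
   lemmas apply. *)
have meritE : merit A C F = EFin \o f.
  by apply/funext => x; rewrite /= fineK//; exact: merit_fin.
have f_ge0 x : A x -> 0 <= f x.
  by move=> Ax; have := merit_ge0 F C_cone C0 C0' Ax; rewrite meritE lee_fin.
have f_le0 x : Ahat x -> f x <= 0.
  by move=> hx; have := merit_le0 F_continuous C0 C0' hx; rewrite meritE lee_fin.
have Ew_hat : Ew `<=` Ahat by exact: weakly_efficient_hat_set.
have Ax : A xbar by case: xbar_eff.
have fx0 : f xbar = 0.
  by apply/eqP; rewrite eq_le f_ge0// f_le0//; exact: Ew_hat.
have [M M0 merM] := merit_lip A F_continuous C0 C0'.
have flip x y : f x <= f y + M * `|x - y|.
  by have := merM x y; rewrite meritE -EFinD lee_fin.
have fscale l v : 0 < l -> l <= 1 -> l * f (xbar + v) <= f (xbar + l *: v).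
  move=> l0 l1; have := merit_scale F v A_convex C_cone C0 C0' Ax l0 l1.
  by rewrite meritE -EFinM lee_fin.
have sub1 : tangent_cone Ew xbar `<=` TAcap.
  move=> d Td; split; last exact: tangent_coneS Td.
  by apply: tangent_coneS Td => x [].
have sub2 : TAcap `<=` K.
  move=> d [TA TB]; split=> //; rewrite meritE; apply/is_dirderiv_EFin.
  exact: dirderiv_tangent_cones M0 flip fx0 fscale f_ge0 f_le0 TA TB.
split=> // -[tau [delta [tau0 delta0 eb]]].
(* This inclusion closes the cycle of three, so all the sets coincide. *)
have sub3 : K `<=` tangent_cone Ew xbar.
  move=> d [TA]; rewrite meritE => /is_dirderiv_EFin.
  apply: (tangent_cone_error_bound M0 flip fx0 tau0 delta0) TA => y Ay yd.
  by have := eb y Ay yd; rewrite meritE.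
split; apply/seteqP; split=> //.
- exact: subset_trans sub2 sub3.
- exact: subset_trans sub3 sub1.
Qed.
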